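(* Let $(k_n)_{n\in\mathbb{N}}$ be an increasing sequence of natural numbers such that $k_1>1$ and the set $\mathbb{N}\setminus\{k_n:n\in\mathbb{N}\}$ is infinite. Put $$x_j=\left\{\begin{array}{ll}\frac{2}{3^{j-1}}&\text{if }j\in\{k_n:n\in\mathbb{N}\},\\ \frac{1}{3^{j-1}}&\text{if }j\notin\{k_n:n\in\mathbb{N}\}.\end{array}\right.$$ Then $|E(x)+E(x)|=|E(x)-E(x)|=3$.
   Context: $\mathbb{N}=\{1,2,\dots\}$; $|A|$ is Lebesgue measure; $A\pm B=\{a\pm b:a\in A,b\in B\}$. For a sequence $x=(x_j)$ of positive numbers with $\sum_j x_j$ convergent, $E(x)=\{\sum_{j\in A}x_j:A\subset\mathbb{N}\}$ is the achievement set of $x$. *)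

(* Defs.v *)
From mathcomp Require Import all_boot all_order all_algebra.
From mathcomp Require Import all_classical all_reals all_analysis.
Import Order.TTheory GRing.Theory Num.Theory.
Import numFieldNormedType.Exports.
Set Implicit Arguments.
Unset Strict Implicit.
Unset Printing Implicit Defensive.
Local Open Scope classical_set_scope.
Local Open Scope ring_scope.

(* The natural numbers start at 1. Sequences indexed by them are functions on
   nat whose value at 0 is irrelevant. *)
Definition Npos : set nat := [set n | (1 <= n)%N].

(* The sum over A is the limit of the partial sums, so no junk value arises
   when it diverges. *)
Definition achievement_set (R : realType) (x : nat -> R) : set R :=
  [set s | exists2 A : set nat, A `<=` Npos &
     (fun n : nat => \sum_(1 <= j < n.+1 | j \in A) x j) @ \oo --> s].

Definition sumset (R : realType) (A B : set R) : set R :=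
  [set a + b | a in A & b in B].

Definition diffset (R : realType) (A B : set R) : set R :=
  [set a - b | a in A & b in B].

(* Main.v *)
(* Both E(x) + E(x) and, up to translation, E(x) - E(x) consist of the sums
   [\sum_i e_i x_i] with free digits e_i in {0, 1, 2}. After scaling, the sums
   of the first n terms form a set S_n of 3^n distinct naturals, because the
   multiples of the last scaled term by 0, 1, 2 are a complete residue system
   modulo 3. The set in question is the decreasing intersection of the compact
   sets F_n = 3/3^n (S_n + [0, 2]). As F_n contains 3^n disjoint cells of
   length 3/3^n, its measure is at least 3; it exceeds 3 only through the
   B_n elements p of S_n with p + 1 not in S_n. Passing from n to n + 1
   multiplies the bound on B_n by 3 when the new index is some k_m, and by 1
   otherwise, so that B_n / 3^n tends to 0 as soon as infinitely many indices
   are of the second kind. *)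
Require Import Defs.
From mathcomp Require Import all_boot all_order all_algebra.
From mathcomp Require Import all_classical all_reals all_analysis.
From mathcomp Require Import zify ring lra.
Import Order.TTheory GRing.Theory Num.Theory.
Import numFieldNormedType.Exports.
Local Open Scope classical_set_scope.
Local Open Scope ring_scope.

(** * Integer prefix sums and their runs of consecutive values *)

(* [b i] tells whether the 0-based term [i] is [2 / 3 ^+ i] or [1 / 3 ^+ i]. *)
Fixpoint prefix_sums (b : nat -> bool) (n : nat) : seq nat :=
  if n is m.+1 then
    [seq (3 * p + a * (b m).+1)%N | p <- prefix_sums b m, a <- iota 0 3]
  else [:: 0%N].

Lemma prefix_sumsS (b : nat -> bool) (n q : nat) :
  reflect (exists p a : nat, [/\ p \in prefix_sums b n, (a <= 2)%N
             & q = (3 * p + a * (b n).+1)%N])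
          (q \in prefix_sums b n.+1).
Proof.
apply: (iffP allpairsP) => [[[p a] [pS]]|[p [a [pS a2 ->]]]].
  by rewrite mem_iota => a3 ->; exists p, a.
by exists (p, a); split => //; rewrite mem_iota.
Qed.

Lemma size_prefix_sums (b : nat -> bool) (n : nat) :
  size (prefix_sums b n) = (3 ^ n)%N.
Proof.
elim: n => // n IH; rewrite expnS mulnC -IH; exact: size_allpairs.
Qed.

(* Both [{0, 1, 2}] and [{0, 2, 4}] are complete residue systems modulo 3. *)
Lemma prefix_sums_uniq (b : nat -> bool) (n : nat) : uniq (prefix_sums b n).
Proof.
elim: n => // n IH; apply: allpairs_uniq => //.
move=> _ _ /allpairsP[[p a] [_ + ->]] /allpairsP[[q c] [_ + ->]].
rewrite !mem_iota /uncurry /= => a3 c3.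
by case: (b n) => /= eq_pq; congr pair; lia.
Qed.

Lemma count_sum (T : Type) (P : pred T) (s : seq T) :
  count P s = (\sum_(p <- s) P p)%N.
Proof.
by rewrite -sum1_count big_mkcond; apply: eq_bigr => p _; case: (P p).
Qed.

Lemma count_prefix_sumsS (b : nat -> bool) (n : nat) (P : pred nat) :
  count P (prefix_sums b n.+1) =
  (\sum_(p <- prefix_sums b n) (P (3 * p) + P (3 * p + (b n).+1)
                                + P (3 * p + 2 * (b n).+1)))%N.
Proof.
rewrite -sum1_count big_mkcond [LHS]big_allpairs_dep.
apply: eq_bigr => p _.
rewrite !big_cons big_nil mul0n mul1n !addn0.
by do 3 case: (P _).
Qed.

(** Each maximal run of consecutive prefix sums has exactly one last element, so this is the number
    of runs. *)
Definition run_ends (b : nat -> bool) (n : nat) : nat :=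
  count (fun p => p.+1 \notin prefix_sums b n) (prefix_sums b n).

(** The same runs, counted at their first elements. The image under [succn] replaces a test on
    [p.-1]: as [0.-1] is [0], that test would miss the run starting at [0]. *)
Definition run_starts (b : nat -> bool) (n : nat) : nat :=
  count (fun p => p \notin map succn (prefix_sums b n)) (prefix_sums b n).

Lemma mem_map_succn (s : seq nat) (p : nat) :
  (p.+1 \in map succn s) = (p \in s).
Proof. by rewrite mem_map //; exact: succn_inj. Qed.

(** If [b n] is false, [p] yields [3p], [3p+1], [3p+2]; only the last can end a run, and only when
    [p+1] is missing. If [b n] is true, it yields [3p], [3p+2], [3p+4]: the successors [3p+3] and
    [3p+5] are present as soon as [p+1] is, and the successor [3p+1 = 3(p-1)+4] as soon as [p-1] is.
    This last case brings in [run_starts]. *)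
Lemma run_endsS (b : nat -> bool) (n : nat) :
  (run_ends b n.+1 <= if b n then 2 * run_ends b n + run_starts b n
                      else run_ends b n)%N.
Proof.
rewrite /run_ends /run_starts count_prefix_sumsS.
rewrite !count_sum; set S := prefix_sums b n.
rewrite [leqRHS](_ : _ = \sum_(p <- S) if b n
    then 2 * (p.+1 \notin S) + (p \notin map succn S) else (p.+1 \notin S))%N;
  last by case: (b n); rewrite // big_split -big_distrr.
rewrite big_seq [leqRHS]big_seq; apply: leq_sum => p pS.
have step q a r : r = (3 * q + a * (b n).+1)%N -> (a <= 2)%N ->
    (r \notin prefix_sums b n.+1 <= (q \notin S))%N.
  move=> rE a2; case: (boolP (q \in S)) => [qS|_]; last by rewrite leq_b1.
  rewrite leqn0 eqb0 negbK; apply/prefix_sumsS; by exists q, a.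
case: (b n) step => /= step; last first.
  have h0 := step p 1%N (3 * p).+1%N ltac:(lia) isT.
  have h1 := step p 2%N (3 * p + 1).+1%N ltac:(lia) isT.
  have h2 := step p.+1 0%N (3 * p + 2 * 1).+1%N ltac:(lia) isT.
  by apply: leq_trans (leq_add (leq_add h0 h1) h2) _; rewrite pS.
have h1 := step p.+1 0%N (3 * p + 2).+1%N ltac:(lia) isT.
have h2 := step p.+1 1%N (3 * p + 2 * 2).+1%N ltac:(lia) isT.
have h0 : ((3 * p).+1%N \notin prefix_sums b n.+1 <= (p \notin map succn S))%N.
  case: p {h1 h2} pS => [|p] pS; last first.
    by rewrite mem_map_succn; apply: (step p 2%N) => //; lia.
  by rewrite [X in (_ <= X)%N](_ : _ = 1%N) ?leq_b1 //; case: mapP => // -[].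
by apply: leq_trans (leq_add (leq_add h0 h1) h2) _; rewrite mul2n -addnn -addnA addnC.
Qed.

(** Mirror image of the previous count: when [b n] is true, the predecessors of [3p] and [3p+2] come
    from [p-1], that of [3p+4] from [p+1]. *)
Lemma run_startsS (b : nat -> bool) (n : nat) :
  (run_starts b n.+1 <= if b n then 2 * run_starts b n + run_ends b n
                        else run_starts b n)%N.
Proof.
rewrite /run_ends /run_starts count_prefix_sumsS !count_sum.
set S := prefix_sums b n.
rewrite [leqRHS](_ : _ = \sum_(p <- S) if b n
    then 2 * (p \notin map succn S) + (p.+1 \notin S)
    else (p \notin map succn S))%N;
  last by case: (b n); rewrite // big_split -big_distrr.
rewrite big_seq [leqRHS]big_seq; apply: leq_sum => p pS.
have step q a r : r = (3 * q + a * (b n).+1).+1%N -> (a <= 2)%N ->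
    (r \notin map succn (prefix_sums b n.+1) <= (q \notin S))%N.
  move=> -> a2; rewrite mem_map_succn.
  case: (boolP (q \in S)) => [qS|_]; last by rewrite leq_b1.
  rewrite leqn0 eqb0 negbK; apply/prefix_sumsS; by exists q, a.
(* Adding 3 on the left expresses descent from [p-1] without truncated subtraction; for [p = 0] the
   right-hand indicator is 1. *)
have step' a r : (r + 3 = 3 * p + a * (b n).+1 + 1)%N -> (a <= 2)%N ->
    (r \notin map succn (prefix_sums b n.+1) <= (p \notin map succn S))%N.
  case: p {pS} => [|p] rE a2; last first.
    by rewrite mem_map_succn; apply: (step p a) => //; lia.
  by rewrite [X in (_ <= X)%N](_ : _ = 1%N) ?leq_b1 //; case: mapP => // -[].
case: (b n) step step' => /= step step'; last first.
  have h0 := step' 2%N (3 * p)%N ltac:(lia) isT.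
  have h1 := step p 0%N (3 * p + 1)%N ltac:(lia) isT.
  have h2 := step p 1%N (3 * p + 2 * 1)%N ltac:(lia) isT.
  by apply: leq_trans (leq_add (leq_add h0 h1) h2) _; rewrite pS; lia.
have h0 := step' 1%N (3 * p)%N ltac:(lia) isT.
have h1 := step' 2%N (3 * p + 2)%N ltac:(lia) isT.
have h2 := step p.+1 0%N (3 * p + 2 * 2)%N ltac:(lia) isT.
by apply: leq_trans (leq_add (leq_add h0 h1) h2) _; rewrite mul2n -addnn.
Qed.

(** The two recurrences are coupled, so ends and starts are bounded by one induction, in which
    [2u + v] at most triples the common bound. *)
Lemma run_ends_le (b : nat -> bool) (n : nat) :
  (run_ends b n <= 3 ^ \sum_(i < n) b i)%N.
Proof.
suff [] : (run_ends b n <= 3 ^ \sum_(i < n) b i)%N /\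
          (run_starts b n <= 3 ^ \sum_(i < n) b i)%N by [].
elim: n => [|n [IHe IHs]]; first by rewrite big_ord0.
rewrite big_ord_recr expnD /=.
move: (run_endsS b n) (run_startsS b n) IHe IHs.
move: (3 ^ _)%N (run_ends b n) (run_starts b n) => X u v.
by case: (b n); rewrite /= ?expn0 ?expn1 => *; split; lia.
Qed.

(** * Lebesgue measure of unions of cells of equal length *)

(** Half-open cells with distinct indices are disjoint, so their lengths add up exactly. *)
Lemma measure_cells (R : realType) (h t : R) (s : seq nat) : 0 < h -> uniq s ->
  lebesgue_measure
    (\big[setU/set0]_(p <- s) `[t + h * p%:R, t + h * p.+1%:R[%classic) =
  (h * (size s)%:R)%:E.
Proof.
move=> h0; elim: s => [|p s IH] /=; first by rewrite big_nil measure0 mulr0.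
move=> /andP[ps us]; rewrite big_cons.
set A := `[_, _[%classic; set B := \big[_/_]_(_ <- _) _.
have -> : lebesgue_measure (A `|` B) =
          (lebesgue_measure A + lebesgue_measure B)%E; first apply: measureU => //.
- exact: measurable_itv.
- rewrite /B -bigcup_seq; apply: bigcup_measurable => q _; exact: measurable_itv.
- rewrite /A /B -subset0 => y [] /=; rewrite in_itv /= => /andP[py yp].
  rewrite -bigcup_seq => -[q /= qs]; rewrite in_itv /= => /andP[qy yq].
  have lt_nat i j : t + h * i%:R <= y -> y < t + h * j.+1%:R -> (i <= j)%N.
    move=> iy yj; rewrite -ltnS -(ltr_nat R) -(ltr_pM2l h0) -(ltrD2l t).
    exact: le_lt_trans yj.
  have pq : p = q by apply/eqP; rewrite eqn_leq (lt_nat p q) // (lt_nat q p).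
  by rewrite pq qs in ps.
rewrite /A /B IH // lebesgue_measure_itv /= lte_fin ltrD2l ltr_pM2l // ltr_nat ltnSn.
by rewrite -EFinD; congr EFin; rewrite -[p.+1]addn1 -[(size s).+1]addn1 !natrD; ring.
Qed.

Lemma measure_closed_cells_le (R : realType) (h t : R) (s : seq nat) : 0 < h ->
  (lebesgue_measure
    (\big[setU/set0]_(p <- s) `[(t + h * p%:R)%R, (t + h * p.+1%:R)%R]%classic)
   <=   (h * (size s)%:R)%:E)%E.
Proof.
move=> h0; elim: s => [|p s IH] /=; first by rewrite big_nil measure0 mulr0.
rewrite big_cons.
set A := `[_, _]%classic; set B := \big[_/_]_(_ <- _) _.
have : (lebesgue_measure (A `|` B) <=
        lebesgue_measure A + lebesgue_measure B)%E.
  apply: measureU2; first exact: measurable_itv.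
  rewrite /B -bigcup_seq; apply: bigcup_measurable => q _.
  exact: measurable_itv.
move=> /le_trans; apply; apply: le_trans (leeD2l _ IH) _.
rewrite /A lebesgue_measure_itv /= lte_fin ltrD2l ltr_pM2l // ltr_nat ltnSn.
rewrite -EFinD lee_fin -[p.+1]addn1 -[(size s).+1]addn1 !natrD; lra.
Qed.

(** * The covers and their measure *)

(** The tail from index [n] on is at most the sum of [4 / 3 ^+ i] over [i >= n], which is
    [6 / 3 ^+ n], or two cells: hence [p.+2]. The translation [t] serves the difference set. *)
Definition level_cover (R : realType) (b : nat -> bool) (t : R) (n : nat) :
    set R :=
  \big[setU/set0]_(p <- prefix_sums b n)
    `[t + 3 / 3 ^+ n * p%:R, t + 3 / 3 ^+ n * p.+2%:R]%classic.

Lemma level_coverP (R : realType) (b : nat -> bool) (t : R) (n : nat) (y : R) :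
  level_cover R b t n y <->
  exists2 p, p \in prefix_sums b n &
    t + 3 / 3 ^+ n * p%:R <= y <= t + 3 / 3 ^+ n * p.+2%:R.
Proof.
rewrite /level_cover -bigcup_seq; split=> -[p pS].
  by rewrite /= in_itv /=; exists p.
by move=> yp; exists p => //=; rewrite in_itv.
Qed.

Lemma measurable_level_cover (R : realType) (b : nat -> bool) (t : R)
  (n : nat) : measurable (level_cover R b t n).
Proof. by apply: bigsetU_measurable. Qed.

Lemma measure_level_cover_ge (R : realType) (b : nat -> bool) (t : R)
  (n : nat) : (3%:E <= lebesgue_measure (level_cover R b t n))%E.
Proof.
have h0 : 0 < 3 / 3 ^+ n :> R by rewrite divr_gt0 ?exprn_gt0.
have -> : 3%:E = lebesgue_measure (\big[setU/set0]_(p <- prefix_sums b n)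
    `[t + 3 / 3 ^+ n * p%:R, t + 3 / 3 ^+ n * p.+1%:R[%classic).
  rewrite measure_cells ?prefix_sums_uniq // size_prefix_sums natrX.
  by rewrite divfK // expf_neq0.
apply: le_measure; rewrite ?inE //.
- by apply: bigsetU_measurable.
- exact: measurable_level_cover.
rewrite -bigcup_seq => y [p /= pS]; rewrite in_itv /= => /andP[py yp].
apply/level_coverP; exists p => //; rewrite py (le_trans (ltW yp)) //.
by rewrite lerD2l ler_pM2l // ler_nat.
Qed.

(** Each interval consists of the cells [p] and [p.+1], and the second is new only if [p.+1] is not
    a prefix sum. Thus at most [3 ^ n + run_ends b n] cells suffice. *)
Lemma measure_level_cover_le (R : realType) (b : nat -> bool) (t : R)
  (n : nat) : (lebesgue_measure (level_cover R b t n) <=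
               (3 + 3 / 3 ^+ (\sum_(i < n) ~~ b i)%N)%:E)%E.
Proof.
have h0 : 0 < 3 / 3 ^+ n :> R by rewrite divr_gt0 ?exprn_gt0.
pose S := prefix_sums b n.
pose s := S ++ [seq p.+1 | p <- S & p.+1 \notin S].
apply: (@le_trans _ _ (lebesgue_measure (\big[setU/set0]_(p <- s)
    `[t + 3 / 3 ^+ n * p%:R, t + 3 / 3 ^+ n * p.+1%:R]%classic))).
  apply: le_measure; rewrite ?inE.
  - exact: measurable_level_cover.
  - by apply: bigsetU_measurable.
  move=> y /level_coverP[p pS /andP[py yp]]; rewrite -bigcup_seq.
  have [yp1|py1] := leP y (t + 3 / 3 ^+ n * p.+1%:R).
    by exists p; rewrite /= ?mem_cat ?pS // in_itv /= py.
  exists p.+1; last by rewrite /= in_itv /= (ltW py1).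
  rewrite /= mem_cat; case: (boolP (p.+1 \in S)) => //= p1S.
  by rewrite mem_map ?mem_filter ?p1S //; exact: succn_inj.
apply: le_trans (measure_closed_cells_le _ _ _ _ h0) _.
rewrite lee_fin size_cat size_map size_filter size_prefix_sums.
have -> : count (fun p => p.+1 \notin S) S = run_ends b n by [].
(* True and false indices number [n] together, so the bound on [run_ends] cancels all factors of
   [3 ^+ n] except those from the false ones. *)
have kz : (\sum_(i < n) b i + \sum_(i < n) ~~ b i)%N = n.
  rewrite -big_split /= -[RHS]card_ord -sum1_card.
  by apply: eq_bigr => i _; case: (b i).
rewrite natrD mulrDr natrX divfK ?expf_neq0 // lerD2l.
rewrite -{1}kz exprD -mulrA ler_pM2l // invfM mulrAC ler_piMl ?invr_ge0 ?exprn_ge0 //.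
by rewrite mulrC ler_pdivrMr ?exprn_gt0 // mul1r -natrX ler_nat run_ends_le.
Qed.

(** * Digit expansions of the points common to all covers *)

Lemma cell_right_end (R : realType) (t : R) (n p : nat) :
  t + 3 / 3 ^+ n * p.+2%:R = t + 3 / 3 ^+ n * p%:R + 6 / 3 ^+ n.
Proof. by rewrite -(addn2 p) (natrD _ p 2); ring. Qed.

(** A child starts at [3p+4] at the latest, hence ends by [3p+6 = 3(p+2)], the right end of its
    parent on the finer scale. *)
Lemma child_cell_sub (R : realType) (b : nat -> bool) (t y : R) (n p a : nat) :
  (a <= 2)%N ->
  t + 3 / 3 ^+ n.+1 * (3 * p + a * (b n).+1)%:R <= y
    <= t + 3 / 3 ^+ n.+1 * (3 * p + a * (b n).+1).+2%:R ->
  t + 3 / 3 ^+ n * p%:R <= y <= t + 3 / 3 ^+ n * p.+2%:R.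
Proof.
move=> a2; set h := 3 / 3 ^+ n.+1 => /andP[py yp].
have h0 : 0 < h by rewrite divr_gt0 ?exprn_gt0.
have scale q : 3 / 3 ^+ n * q%:R = h * (3 * q)%:R.
  rewrite natrM mulrA; congr (_ * _).
  by rewrite /h exprS; field; rewrite expf_neq0.
have ab : (a * (b n).+1 <= 4)%N by rewrite (leq_mul a2 (_ : _ <= 2)%N) //; case: (b n).
apply/andP; split.
  apply: le_trans py; rewrite scale lerD2l ler_pM2l // ler_nat; lia.
by apply: (le_trans yp); rewrite scale lerD2l ler_pM2l // ler_nat; lia.
Qed.

Definition digit_sum (R : realType) (b : nat -> bool) (e : nat -> nat)
    (n : nat) : R :=
  \sum_(i < n) (e i * (b i).+1)%:R / 3 ^+ i.

Lemma digit_sumS (R : realType) (b : nat -> bool) (e : nat -> nat) (n : nat) :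
  digit_sum R b e n.+1 =
  digit_sum R b e n + (e n * (b n).+1)%:R / 3 ^+ n.
Proof. by rewrite /digit_sum big_ord_recr. Qed.

(** A branch of length [m] below the node [p] of level [n], ending in an interval around [y]. The
    recursion peels off the first digit, the one that the choice below has to fix. *)
Fixpoint extends (R : realType) (b : nat -> bool) (t y : R) (m n p : nat) :
    Prop :=
  if m is m'.+1 then
    exists2 a, (a <= 2)%N & extends R b t y m' n.+1 (3 * p + a * (b n).+1)
  else t + 3 / 3 ^+ n * p%:R <= y <= t + 3 / 3 ^+ n * p.+2%:R.

(** Intervals are nested along a branch, so a branch may lose its last level. *)
Lemma extends_le (R : realType) (b : nat -> bool) (t y : R) (m m' n p : nat) :
  (m <= m')%N -> extends R b t y m' n p -> extends R b t y m n p.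
Proof.
move=> /subnK <-; elim: (m' - m)%N => // {m'} k IH ext; apply: IH.
move: ext; rewrite addSn; elim: (k + m)%N n p => [|m' IH] n p [a a2 ext].
  exact: child_cell_sub ext.
by exists a => //; exact: IH.
Qed.

Lemma level_cover_extends (R : realType) (b : nat -> bool) (t y : R) (n : nat) :
  level_cover R b t n y -> extends R b t y n 0 0.
Proof.
(* A branch below [p] is prolonged upwards, parent by parent, to the root. *)
have back m p : p \in prefix_sums b n ->
    extends R b t y m n p -> extends R b t y (n + m) 0 0.
  elim: n m p => [|n IH] m p; first by rewrite inE => /eqP ->.
  move=> /prefix_sumsS[q [a [qS a2 ->]]] ext.
  by rewrite addSnnS; apply: (IH _ q) => //; exists a.
by move=> /level_coverP[p pS yp]; rewrite -[n]addn0; apply: (back _ p).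
Qed.

(* König's lemma for the ternary tree of digit choices. *)
Lemma bigcap_level_cover_digits (R : realType) (b : nat -> bool) (t y : R) :
  (\bigcap_n level_cover R b t n) y ->
  exists2 e : nat -> nat, (forall n, (e n <= 2)%N) &
    forall n, t + digit_sum R b e n <= y <= t + digit_sum R b e n + 6 / 3 ^+ n.
Proof.
move=> yF.
pose good n p := forall m, extends R b t y m n p.
have good00 : good 0%N 0%N by move=> m; apply: level_cover_extends; exact: yF.
(* Good nodes have branches of every length. The existential stands outside the implication so that
   [choice] gives a total function; at other nodes the digit is a dummy 0. *)
have good_step n p : exists a, good n p ->
    (a <= 2)%N /\ good n.+1 (3 * p + a * (b n).+1)%N.
  have [gp|] := pselect (good n p); last by exists 0%N.
  apply: contrapT => /forallNP noa.
  have bad a : (a <= 2)%N ->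
      exists m, ~ extends R b t y m n.+1 (3 * p + a * (b n).+1).
    by move=> a2; apply/existsNP => ga; apply: (noa a).
  (* If all three children failed, at depths [m0], [m1], [m2], then by monotonicity none would have
     a branch as long as the sum of these depths. *)
  have [m0 b0] := bad 0%N isT; have [m1 b1] := bad 1%N isT.
  have [m2 b2] := bad 2%N isT.
  have [a a2 /extends_le ext] := gp (m0 + m1 + m2).+1.
  case: a a2 ext => [|[|[|//]]] _ ext.
  - by apply: b0; apply: ext; lia.
  - by apply: b1; apply: ext; lia.
  - by apply: b2; apply: ext; lia.
have [f fP] := choice (fun np : nat * nat => good_step np.1 np.2).
(* The chosen digits, followed from the root, trace an infinite branch through the nodes [P n]. *)
pose P := fix P n := if n is m.+1 then (3 * P m + f (m, P m) * (b m).+1)%N else 0%N.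
pose e i := f (i, P i).
have goodP n : good n (P n).
  by elim: n => // n IH; have [] := fP (n, P n) IH.
have PE n : digit_sum R b e n = 3 / 3 ^+ n * (P n)%:R :> R.
  elim: n => [|n IH]; first by rewrite /digit_sum big_ord0 mulr0.
  rewrite digit_sumS IH natrD natrM mulrDr exprS invfM.
  by field; rewrite expf_neq0.
exists e => [n|n]; first by have [] := fP (n, P n) (goodP n).
by rewrite PE -cell_right_end; exact: (goodP n 0%N).
Qed.

Lemma digits_level_cover (R : realType) (b : nat -> bool) (t y : R)
  (e : nat -> nat) (n : nat) : (forall i, (e i <= 2)%N) ->
  t + digit_sum R b e n <= y <= t + digit_sum R b e n + 6 / 3 ^+ n ->
  level_cover R b t n y.
Proof.
move=> e2 yn.
have [p pS pE] : exists2 p, p \in prefix_sums b n &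
    digit_sum R b e n = 3 / 3 ^+ n * p%:R :> R.
  elim: n {yn} => [|n [p pS IH]]; first exists 0%N.
  - by rewrite inE.
  - by rewrite /digit_sum big_ord0 mulr0.
  exists (3 * p + e n * (b n).+1)%N; first by apply/prefix_sumsS; exists p, (e n).
  rewrite digit_sumS IH natrD natrM mulrDr exprS invfM.
  by field; rewrite expf_neq0.
apply/level_coverP; exists p => //; by rewrite cell_right_end -pE.
Qed.

(** * Measure of the intersection *)

(** The upper bound is monotonicity, with an excess [3 / 3 ^+ M] for arbitrarily large [M]; the
    lower bound passes to the limit by continuity from above. *)
Lemma measure_bigcap_level_cover (R : realType) (b : nat -> bool) (t : R) :
  (forall N, exists2 n, (N <= n)%N & ~~ b n) ->
  lebesgue_measure (\bigcap_n level_cover R b t n) = 3%:E.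
Proof.
move=> coinf; set G := \bigcap_n _.
have mG : measurable G.
  by apply: bigcap_measurable => // n _; exact: measurable_level_cover.
apply/eqP; rewrite eq_le; apply/andP; split.
  have zP M : exists n, (M <= \sum_(i < n) ~~ b i)%N.
    elim: M => [|M [n Mn]]; first by exists 0%N.
    have [m nm bm] := coinf n; exists m.+1.
    rewrite big_ord_recr /= bm addn1 ltnS (leq_trans Mn) //.
    rewrite -(big_mkord xpredT (fun i => ~~ b i : nat)).
    rewrite -(big_mkord xpredT (fun i => ~~ b i : nat)).
    by rewrite (big_cat_nat (leq0n n) nm) leq_addr.
  have Gle M : (lebesgue_measure G <= (3 + 3 / 3 ^+ M)%:E)%E.
    have [n Mn] := zP M.
    apply: (@le_trans _ _ (lebesgue_measure (level_cover R b t n))).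
      apply: le_measure; rewrite ?inE //; first exact: measurable_level_cover.
      by move=> y; apply.
    apply: le_trans (measure_level_cover_le _ _ _ _) _.
    rewrite lee_fin lerD2l ler_pM2l // lef_pV2 ?posrE ?exprn_gt0 //.
    by rewrite ler_weXn2l // ler1n.
  apply/lee_addgt0Pr => eps eps0.
  have [M Meps] : exists M : nat, 3 / 3 ^+ M <= eps.
    pose M := (Num.truncn (3 / eps)).+1; exists M.
    have M3 : (M%:R : R) <= 3 ^+ M.
      by rewrite -natrX ler_nat ltnW // ltn_expl.
    rewrite ler_pdivrMr ?exprn_gt0 // mulrC -ler_pdivrMr //.
    by apply: le_trans (ltW _) M3; exact: truncnS_gt.
  by apply: le_trans (Gle M) _; rewrite -EFinD lee_fin lerD2l.
(* Continuity from above asks for one cover of finite measure. *)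
have F0 : (lebesgue_measure (level_cover R b t 0%N) < +oo)%E.
  exact: le_lt_trans (measure_level_cover_le _ _ _ _) (ltry _).
have noninc : {homo level_cover R b t : m n / (m <= n)%N >-> (n <= m)%O}.
  apply/nonincreasing_seqP => n; apply/subsetPset => y.
  move=> /level_coverP[q /prefix_sumsS[p [a [pS a2 ->]]] yq].
  by apply/level_coverP; exists p => //; exact: child_cell_sub yq.
have := nonincreasing_cvg_mu F0 (measurable_level_cover R b t) mG noninc.
move=> /cvge_to_ge; apply; apply: nearW => n; exact: measure_level_cover_ge.
Qed.

(** * Convergence of digit sums *)

(** A term is at most [4 / 3 ^+ n = 6 / 3 ^+ n - 6 / 3 ^+ n.+1], so the upper bound telescopes. *)
Lemma digit_sum_bounds (R : realType) (b : nat -> bool) (e : nat -> nat)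
  (m n : nat) : (forall i, (e i <= 2)%N) -> (m <= n)%N ->
  digit_sum R b e m <= digit_sum R b e n
    <= digit_sum R b e m + 6 / 3 ^+ m - 6 / 3 ^+ n.
Proof.
move=> e2 /subnK <-; elim: (n - m)%N => [|k IH].
  by rewrite add0n lexx addrK lexx.
rewrite addSn digit_sumS; move: IH; set d := digit_sum _ _ _ (k + m).
set E := digit_sum _ _ _ m => /andP[lo hi].
have v0 : 0 < (3 ^+ (k + m))^-1 :> R by rewrite invr_gt0 exprn_gt0.
have c4 : (e (k + m)%N * (b (k + m)%N).+1)%:R <= 4 :> R.
  by rewrite ler_nat (leq_mul (e2 _) (_ : _ <= 2)%N) //; case: (b _).
have c0 : 0 <= (e (k + m)%N * (b (k + m)%N).+1)%:R :> R by [].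
move: c4 c0; set c := _%:R => c4 c0.
have eq3 : 6 / 3 ^+ (k + m).+1 = 2 / 3 ^+ (k + m) :> R.
  by rewrite exprS; field; rewrite expf_neq0.
rewrite eq3; apply/andP; split.
  by apply: le_trans lo _; rewrite lerDl mulr_ge0 // ltW.
have : c / 3 ^+ (k + m) <= 4 / 3 ^+ (k + m) by rewrite ler_pM2r.
lra.
Qed.

(** The intervals are nested with lengths tending to 0, so the limit is their only common point. *)
Lemma digit_sum_cvgP (R : realType) (b : nat -> bool) (e : nat -> nat) (s : R) :
  (forall i, (e i <= 2)%N) ->
  digit_sum R b e @ \oo --> s <->
  forall n, digit_sum R b e n <= s <= digit_sum R b e n + 6 / 3 ^+ n.
Proof.
move=> e2; split=> [es n|sn].
  have bounds m : (n <= m)%N -> digit_sum R b e n <= digit_sum R b e m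
      <= digit_sum R b e n + 6 / 3 ^+ n.
    move=> nm; have /andP[-> hi] := digit_sum_bounds R b e n m e2 nm.
    by apply: le_trans hi _; rewrite gerBl divr_ge0 ?exprn_ge0.
  apply/andP; split.
    by apply: (cvgr_to_ge es); exists n => // m /bounds /andP[].
  by apply: (cvgr_to_le es); exists n => // m /bounds /andP[].
apply: (@squeeze_cvgr _ _ _ _ (fun n => s - 6 / 3 ^+ n) (fun=> s)).
- by apply: nearW => n; have /andP[lo hi] := sn n; rewrite lo andbT lerBlDr.
- rewrite -[X in _ --> X]subr0; apply: cvgB; first exact: cvg_cst.
  have -> : (fun n => 6 / 3 ^+ n) = geometric 6 (3^-1 : R).
    by apply/funext => n; rewrite /geometric /= exprVn.
  by apply: cvg_geometric; rewrite ger0_norm ?invr_ge0 // invf_lt1 // ltr1n.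
- exact: cvg_cst.
Qed.

Lemma is_cvg_digit_sum (R : realType) (b : nat -> bool) (e : nat -> nat) :
  (forall i, (e i <= 2)%N) -> exists s : R, digit_sum R b e @ \oo --> s.
Proof.
move=> e2; exists (limn (digit_sum R b e)); apply: nondecreasing_is_cvgn.
  by move=> m n mn; have /andP[] := digit_sum_bounds R b e m n e2 mn.
exists (digit_sum R b e 0 + 6) => _ [n _ <-].
have /andP[_ hi] := digit_sum_bounds R b e 0 n e2 isT.
by apply: le_trans hi _; rewrite expr0 divr1 gerBl divr_ge0 ?exprn_ge0.
Qed.

Lemma bigcap_level_coverP (R : realType) (b : nat -> bool) (t y : R) :
  (\bigcap_n level_cover R b t n) y <->
  exists2 e : nat -> nat, (forall n, (e n <= 2)%N) &
    digit_sum R b e @ \oo --> y - t.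
Proof.
split=> [/bigcap_level_cover_digits[e e2 ye]|[e e2 ye] n _].
  exists e => //; apply/digit_sum_cvgP => // n.
  by have := ye n; rewrite lerBrDl lerBlDl addrA.
apply: (digits_level_cover _ _ _ _ e) => //.
by have /digit_sum_cvgP /(_ n) := ye; rewrite lerBrDl lerBlDl addrA; apply.
Qed.

Lemma digit_sumD (R : realType) (b : nat -> bool) (e f : nat -> nat) :
  digit_sum R b (fun i => (e i + f i)%N) = digit_sum R b e \+ digit_sum R b f.
Proof.
apply/funext => n; rewrite /= /digit_sum -big_split; apply: eq_bigr => i _ /=.
by rewrite -mulrDl -natrD mulnDl.
Qed.

Lemma digit_sum_cvgD (R : realType) (b : nat -> bool) (e f g : nat -> nat)
  (u v : R) : (forall i, g i = e i + f i)%N -> digit_sum R b e @ \oo --> u ->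
  digit_sum R b f @ \oo --> v -> digit_sum R b g @ \oo --> u + v.
Proof.
move=> efg eu fv; have -> : g = (fun i => e i + f i)%N by apply/funext.
rewrite digit_sumD; exact: cvgD.
Qed.

(** The digits of a difference are specified through an addition because subtraction on [nat]
    truncates. *)
Lemma digit_sum_cvgB (R : realType) (b : nat -> bool) (e f g : nat -> nat)
  (u v : R) : (forall i, g i = e i + f i)%N -> digit_sum R b g @ \oo --> u ->
  digit_sum R b f @ \oo --> v -> digit_sum R b e @ \oo --> u - v.
Proof.
move=> efg gu fv.
have -> : digit_sum R b e = digit_sum R b g \- digit_sum R b f.
  have -> : g = (fun i => e i + f i)%N by apply/funext.
  by rewrite digit_sumD; apply/funext => n /=; rewrite addrK.
exact: cvgB.
Qed.

(** * Sums and differences of achievement sets *)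

Lemma achievement_setP (R : realType) (b : nat -> bool) (x : nat -> R) (s : R) :
  (forall i, x i.+1 = (b i).+1%:R / 3 ^+ i) ->
  achievement_set x s <->
  exists a : nat -> bool, digit_sum R b (fun i => a i) @ \oo --> s.
Proof.
move=> xb.
have sumE (A : set nat) : (fun n => \sum_(1 <= j < n.+1 | j \in A) x j)
    = digit_sum R b (fun i => i.+1 \in A).
  apply/funext => n; rewrite big_mkcond big_add1 big_mkord.
  by apply: eq_bigr => i _; case: ifP => _; rewrite ?xb ?mul1n // mul0n mul0r.
split=> [[A _]|[a as_]]; first by rewrite sumE; exists (fun i => i.+1 \in A).
exists [set j | (1 <= j)%N /\ a j.-1]; first by move=> j [].
rewrite sumE (_ : (fun i => _) = (fun i => a i : nat)) //.
apply/funext => i; congr nat_of_bool; apply/idP/idP; first by rewrite inE => -[].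
by move=> ai; rewrite inE.
Qed.

Lemma sumset_achievement (R : realType) (b : nat -> bool) (x : nat -> R) :
  (forall i, x i.+1 = (b i).+1%:R / 3 ^+ i) ->
  sumset (achievement_set x) (achievement_set x) =
  \bigcap_n level_cover R b 0 n.
Proof.
move=> xb; have aP s := achievement_setP R b x s xb.
apply/seteqP; split=> y.
  move=> [u /aP[a au] [v /aP[a' av] <-]]; apply/bigcap_level_coverP.
  have e2 i : (a i + a' i <= 2)%N by case: (a i) (a' i) => [] [].
  exists (fun i => (a i + a' i)%N) => //; rewrite subr0.
  exact: digit_sum_cvgD au av.
move=> /bigcap_level_coverP[e e2]; rewrite subr0 => ey.
(* A digit [e] in {0, 1, 2} splits as [(0 < e) + (1 < e)]. *)
have [u au] := is_cvg_digit_sum R b (fun i => 0 < e i : nat)%N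
  (fun i => leq_trans (leq_b1 _) (leqnSn 1)).
exists u; first by apply/aP; exists (fun i => 0 < e i)%N.
exists (y - u); last by rewrite addrC subrK.
apply/aP; exists (fun i => 1 < e i)%N; apply: digit_sum_cvgB ey au => i.
by have := e2 i; case: (e i) => [|[|[|]]].
Qed.

(** The digit difference [a - a'] equals [(a + (1 - a')) - 1]. With [c] the sum of the whole series,
    adding [c] to a difference therefore gives digits in {0, 1, 2}, whence [t = - c]. *)
Lemma diffset_achievement (R : realType) (b : nat -> bool) (x : nat -> R) :
  (forall i, x i.+1 = (b i).+1%:R / 3 ^+ i) ->
  exists t : R, diffset (achievement_set x) (achievement_set x) =
    \bigcap_n level_cover R b t n.
Proof.
move=> xb; have aP s := achievement_setP R b x s xb.
have [c oc] := is_cvg_digit_sum R b (fun=> 1%N) (fun=> isT).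
exists (- c); apply/seteqP; split=> y.
  move=> [u /aP[a au] [v /aP[a' av] <-]]; apply/bigcap_level_coverP.
  exists (fun i => a i + ~~ a' i)%N; first by move=> i; case: (a i) (a' i) => [] [].
  rewrite opprK -addrA (addrC _ c); apply: digit_sum_cvgD au _ => //.
  by apply: digit_sum_cvgB oc av => i; case: (a' i).
move=> /bigcap_level_coverP[e e2]; rewrite opprK => ey.
have [u au] := is_cvg_digit_sum R b (fun i => 0 < e i : nat)%N
  (fun i => leq_trans (leq_b1 _) (leqnSn 1)).
exists u; first by apply/aP; exists (fun i => 0 < e i)%N.
exists (u - y); last by rewrite opprB addrC subrK.
(* Here [e = (0 < e) + 1 - (e <= 1)] for each digit [e]. *)
apply/aP; exists (fun i => e i <= 1)%N.
rewrite (_ : u - y = u + c - (y + c)); last by rewrite opprD addrACA subrr addr0.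
apply: digit_sum_cvgB (digit_sum_cvgD _ _ _ _ _ _ _ _ au oc) ey => // i.
by have := e2 i; case: (e i) => [|[|[|]]].
Qed.

Theorem theorem3p5 (R : realType) (k : nat -> nat) (x : nat -> R)
  (k_pos : forall n : nat, Npos n -> Npos (k n))
  (k_incr : forall m n : nat, Npos m -> (m < n)%N -> (k m < k n)%N)
  (k1_gt1 : (1 < k 1)%N)
  (coinf : infinite_set (Npos `\` [set k n | n in Npos]))
  (xE : forall j : nat, Npos j ->
     x j = if j \in [set k n | n in Npos] then 2 / 3 ^+ (j - 1)
           else 1 / 3 ^+ (j - 1)) :
  lebesgue_measure (sumset (achievement_set x) (achievement_set x)) = 3%:E /\
  lebesgue_measure (diffset (achievement_set x) (achievement_set x)) = 3%:E.
Proof.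
pose b i := i.+1 \in [set k n | n in Npos].
have xb i : x i.+1 = (b i).+1%:R / 3 ^+ i.
  by rewrite xE // subn1 /b; case: (_ \in _).
(* If [b] held from [N] on, every positive index outside the range of [k] would be at most [N],
   since [b n] concerns the index [n.+1]. *)
have nb N : exists2 n, (N <= n)%N & ~~ b n.
  apply: contrapT => allb; apply: coinf; apply: (sub_finite_set _ (finite_II N.+1)).
  move=> [|n] [//= _ nk]; rewrite ltnS ltnNge; apply/negP => Nn.
  by apply: allb; exists n => //; rewrite /b notin_setE.
have [t ->] := diffset_achievement R b x xb.
by rewrite (sumset_achievement R b x xb) !measure_bigcap_level_cover.
Qed.
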